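(* Let $G$ be a finite group (written additively, not necessarily abelian), let $H$ be a normal subgroup of $G$, and let $M$ be a set of integers. Suppose that $M$ completely splits $G$ and that $M$ splits $G/H$. Then every complete splitting $G=MS$ (with $S\subseteq G$) induces a complete splitting of $H$, namely $H=M(S\cap H)$ is a complete splitting of $H$.
   Context: Groups are written additively even if they are not abelian; for an integer $m$ and a group element $s$, $ms$ denotes the $m$-th multiple (power) of $s$. For a set of integers $M$ and a subset $S$ of a group, $MS=\{ms: m\in M, s\in S\}$. Let $G$ be a finite group, $M$ a set of integers, $S\subseteq G$. We say that $M$ and $S$ form a complete splitting of $G$, written $G=MS$, if every element $g\in G$ (including $0$) has a unique representation $g=ms$ with $m\in M$, $s\in S$. We say that $M$ and $S$ form a splitting of $G$, written $G\setminus\{0\}=MS$, if every nonzero element $g\in G$ has a unique representation $g=ms$ with $m\in M$, $s\in S$, while $0$ has no such representation. $M$ completely splits (respectively splits) $G$ if there is a subset $S\subseteq G$ such that $M$ and $S$ form a complete splitting (respectively a splitting) of $G$. *)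

(* Defs.v *)
From mathcomp Require Import all_boot all_order all_algebra all_fingroup.

Set Implicit Arguments.
Unset Strict Implicit.
Unset Printing Implicit Defensive.

Local Open Scope group_scope.

(** Groups are written multiplicatively, as in MathComp: the additive [0] is
    [1], and the multiple [m s] is the integer power [zexpg s m]. *)

Definition zexpg (gT : finGroupType) (x : gT) (m : int) : gT :=
  match m with
  | Posz n => x ^+ n
  | Negz n => x ^- n.+1   (* [Negz n] is the integer [- n.+1] *)
  end.

Definition represents (gT : finGroupType) (M : int -> Prop) (S : {set gT})
    (g : gT) (ms : int * gT) : Prop :=
  [/\ M ms.1, ms.2 \in S & g = zexpg ms.2 ms.1].

(** Uniqueness of a representation is uniqueness of the pair [(m, s)]. *)
Definition complete_splitting (gT : finGroupType) (G : {group gT})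
    (M : int -> Prop) (S : {set gT}) : Prop :=
  S \subset G /\
  (forall g, g \in G -> exists! ms, represents M S g ms).

Definition splitting (gT : finGroupType) (G : {group gT})
    (M : int -> Prop) (S : {set gT}) : Prop :=
  [/\ S \subset G,
      forall g, g \in G -> g != 1 -> exists! ms, represents M S g ms
    & ~ exists ms, represents M S 1 ms].

Definition completely_splits (gT : finGroupType) (M : int -> Prop)
    (G : {group gT}) : Prop :=
  exists S : {set gT}, complete_splitting G M S.

Definition splits (gT : finGroupType) (M : int -> Prop)
    (G : {group gT}) : Prop :=
  exists S : {set gT}, splitting G M S.

(* Main.v *)
Require Import Defs.
From mathcomp Require Import all_boot all_order all_algebra all_fingroup.
From mathcomp Require Import cyclic.

(** The idea is to count, for each nontrivial cyclic subgroup [C] of [G / H],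
    the elements whose image generates [C].  Since a power of [x] generates a
    subgroup of [<[x]>] depending only on [<[x]>], both splittings yield the
    same linear system for the numbers of elements of [S] (respectively of the
    splitting set [T] of [G / H], weighted by [#|H|]) generating a given [C].
    The system is triangular for inclusion, with nonzero diagonal because a
    generator of a maximal cyclic subgroup can only be represented by another
    generator.  So if [s \in S] is not in [H], some [t \in T] generates the
    same subgroup of [G / H] as [s]; no [M]-multiple of [t] vanishes, hence no
    [M]-multiple of [s] lies in [H]. *)

Set Implicit Arguments.
Unset Strict Implicit.
Unset Printing Implicit Defensive.

Local Open Scope group_scope.

Lemma cycle_zexpg (gT : finGroupType) (x : gT) (m : int) :
  <[zexpg x m]> = <[x ^+ `|m|%N]>.
Proof. by case: m => n //=; rewrite cycleV. Qed.

Lemma zexpg_eq1 (gT : finGroupType) (x : gT) (m : int) :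
  (zexpg x m == 1) = (#[x] %| `|m|)%N.
Proof. by rewrite -cycle_eq1 cycle_zexpg cycle_eq1 order_dvdn. Qed.

Lemma groupZX (gT : finGroupType) (G : {group gT}) (x : gT) (m : int) :
  x \in G -> zexpg x m \in G.
Proof. by move=> Gx; case: m => n /=; rewrite ?groupV groupX. Qed.

Lemma coset_zexpg (gT : finGroupType) (H : {group gT}) (x : gT) (m : int) :
  x \in 'N(H) -> coset H (zexpg x m) = zexpg (coset H x) m.
Proof.
by move=> Nx; case: m => n /=; rewrite ?morphV ?morphX ?groupX.
Qed.

Lemma eq_cycle_expg (gT : finGroupType) (x y : gT) n :
  <[x]> = <[y]> -> <[x ^+ n]> = <[y ^+ n]>.
Proof.
have sub (u v : gT) : <[u]> = <[v]> -> <[u ^+ n]> \subset <[v ^+ n]>.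
  move=> euv; have /cycleP[i ->] : u \in <[v]> by rewrite -euv cycle_id.
  by rewrite cycle_subG -expgM mulnC expgM mem_cycle.
by move=> exy; apply/eqP; rewrite eqEsubset !sub.
Qed.

(** [M] is an arbitrary predicate, and counting needs it finite. Representing [1] yields some [s0]
    in [S]. Each [m] in [M] is then the first component of the unique representation of
    [zexpg s0 m], so there are at most [#|G|] multipliers. *)
Lemma complete_splitting_enum (gT : finGroupType) (G : {group gT})
    (M : int -> Prop) (S : {set gT}) :
  complete_splitting G M S ->
  exists2 Ms : seq int, uniq Ms & forall m, M m <-> m \in Ms.
Proof.
case=> sSG cS.
have /fin_all_exists[f fP] (g : gT) :
    exists ms, g \in G -> represents M S g ms.
  have [/cS[ms [msP _]] | _] := boolP (g \in G); first by exists ms.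
  (* Outside [G] nothing is required, so the pair is arbitrary. *)
  by exists (0%R, 1).
have [_ S1 _] := fP 1 (group1 G).
exists (undup [seq (f g).1 | g in G]); first exact: undup_uniq.
move=> m; rewrite mem_undup; split=> [Mm | /imageP[g Gg ->]]; last first.
  by case: (fP g Gg).
have Gg : zexpg (f 1).2 m \in G by rewrite groupZX // (subsetP sSG).
apply/imageP; exists (zexpg (f 1).2 m) => //.
have [ms [_ ms_uniq]] := cS _ Gg.
by rewrite -(ms_uniq _ (fP _ Gg)) (ms_uniq (m, (f 1).2)).
Qed.

(** Double counting of the triples [(s, m, g)] with [g = zexpg s m] and [Q g]: a fixed [g] lies in
    exactly one triple, and a fixed pair [(s, m)] in one or none. *)
Lemma card_represented (gT : finGroupType) (M : int -> Prop) (Ms : seq int)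
    (S : {set gT}) (Q : pred gT) :
    uniq Ms -> (forall m, M m <-> m \in Ms) ->
    (forall g, Q g -> exists! ms, represents M S g ms) ->
  #|Q| = (\sum_(s in S) count (fun m => Q (zexpg s m)) Ms)%N.
Proof.
move=> uMs MsP repQ.
transitivity (\sum_(s in S) \sum_(m <- Ms) \sum_(g | Q g) (g == zexpg s m))%N.
  rewrite -sum1_card.
  under [RHS]eq_bigr do rewrite exchange_big.
  rewrite [RHS]exchange_big; apply: eq_bigr => g Qg.
  have [[m0 s0] [[/= /MsP Mm0 Ss0 Dg] rep_uniq]] := repQ g Qg.
  rewrite (bigD1 s0) //= (bigD1_seq m0) //= -Dg eqxx.
  rewrite !big1_seq ?big1 // => [s /andP[/andP[Ss ne_s] _] | m /andP[ne_m Mm]].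
    rewrite big1_seq // => m /andP[_ /MsP Mm]; case: eqP => // Dg'.
    by have [_ es] := rep_uniq (m, s) (And3 Mm Ss Dg'); rewrite es eqxx in ne_s.
  move/MsP: Mm => Mm; case: eqP => // Dg'.
  by have [em] := rep_uniq (m, s0) (And3 Mm Ss0 Dg'); rewrite em eqxx in ne_m.
apply: eq_bigr => s _; rewrite -sum1_count [RHS]big_mkcond.
apply: eq_bigr => m _; case: ifP => [Qsm | nQsm].
  rewrite (bigD1 (zexpg s m)) //= eqxx big1 // => g /andP[_ /negPf-> //].
by rewrite big1 // => g Qg; case: eqP => // Dg; rewrite -Dg Qg in nQsm.
Qed.

(** The coefficients of the linear system, with one equation for each [c] and one unknown for each
    [x]. *)
Definition generation_count (gT : finGroupType) (Ms : seq int) (x c : gT) :=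
  count (fun m => <[zexpg x m]> == <[c]>) Ms.

Lemma eq_generation_count (gT : finGroupType) Ms (x y c : gT) :
  <[x]> = <[y]> -> generation_count Ms x c = generation_count Ms y c.
Proof.
by move=> exy; apply: eq_count => m; rewrite !cycle_zexpg (eq_cycle_expg _ exy).
Qed.

Lemma generation_count_gt0 (gT : finGroupType) Ms (x c : gT) :
  (0 < generation_count Ms x c)%N -> c \in <[x]>.
Proof.
rewrite -has_count => /hasP[m _ /eqP exc].
by rewrite -cycle_subG -exc cycle_zexpg cycleX.
Qed.

(** Generators of the same cyclic subgroup have equal coefficients, so the system determines only
    the sums of the unknowns over such classes. These are found by back substitution, from large
    cyclic subgroups down to small ones. *)
Lemma generator_sum_unique (gT : finGroupType) (K : {group gT}) (Ms : seq int)
    (f1 f2 : gT -> nat) :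
    (forall c, c \in K -> c != 1 -> (0 < generation_count Ms c c)%N) ->
    (forall c, c \in K -> c != 1 ->
      (\sum_(x in K) f1 x * generation_count Ms x c
        = \sum_(x in K) f2 x * generation_count Ms x c)%N) ->
  forall c, c \in K -> c != 1 ->
    (\sum_(x in K | <[x]> == <[c]>) f1 x
       = \sum_(x in K | <[x]> == <[c]>) f2 x)%N.
Proof.
move=> diag_gt0 eq_f c.
have [n] := ubnP (#|K| - #[c]); elim: n c => // n IHn c le_n Kc nt_c.
have sumE (f : gT -> nat) d :
    (\sum_(x in K | <[x]> == <[d]>) f x * generation_count Ms x c
      = (\sum_(x in K | <[x]> == <[d]>) f x) * generation_count Ms d c)%N.
  rewrite big_distrl; apply: eq_bigr => x /andP[_ /eqP exd].
  by rewrite (eq_generation_count _ _ exd).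
(* Naming the conclusion [goal] shields it from the rewrites that split the equation according to
   [<[x]>] and isolate the diagonal term. *)
have := eq_f c Kc nt_c; set goal := (X in _ -> X).
rewrite !(partition_big (fun x : gT => <[x]>) predT) //=.
rewrite !(bigD1 (P := predT) <[c]>) //= !sumE {}/goal.
set r1 := (\sum_(D | D != _) _)%N; set r2 := (\sum_(D | D != _) _)%N.
suff -> : r1 = r2.
  by move/addIn/eqP; rewrite eqn_pmul2r ?diag_gt0 // => /eqP.
apply: eq_bigr => D neDc.
have [/existsP[d /andP[Kd /eqP eD]] | /existsPn noD] :=
    boolP [exists d, (d \in K) && (<[d]> == D)]; last first.
  by rewrite !big1 // => x; rewrite (negPf (noD x)).
(* An off-diagonal term either has coefficient zero or comes from a cyclic group strictly containing
   [<[c]>], where induction applies. *)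
rewrite -eD !sumE; have [-> | ] := posnP (generation_count Ms d c).
  by rewrite !muln0.
move/generation_count_gt0; rewrite -cycle_subG => sCD.
have ltCD : (#[c] < #[d])%N.
  by apply: proper_card; rewrite properEneq sCD andbT eD eq_sym.
congr (_ * _)%N; apply: IHn => //.
  rewrite -ltnS (leq_trans _ le_n) // ltnS ltn_sub2l //.
  by rewrite (leq_trans ltCD) // subset_leq_card ?cycle_subG.
by rewrite -order_gt1 (leq_ltn_trans _ ltCD).
Qed.

(* A cyclic subgroup [<[d]>] of maximal order containing [c] has its generator
   [d] represented as a multiple [m] of another generator, so [m] is coprime
   to [#[d]] and hence to [#[c]]. *)
Lemma splitting_generation_gt0 (gT : finGroupType) (K : {group gT})
    (M : int -> Prop) (Ms : seq int) (T : {set gT}) (c : gT) :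
    (forall m, M m <-> m \in Ms) -> splitting K M T -> c \in K -> c != 1 ->
  (0 < generation_count Ms c c)%N.
Proof.
move=> MsP [sTK repT _] Kc nt_c.
pose P x := (x \in K) && (c \in <[x]>).
have Pc : P c by rewrite /P Kc cycle_id.
case: (arg_maxnP (fun x : gT => #[x]) Pc) => d /andP[Kd cd] d_max.
have nt_d : d != 1.
  by apply: contraNneq nt_c => d1; move: cd; rewrite d1 cycle1 inE.
have [[m t] [[/= Mm Tt Dd] _]] := repT d Kd nt_d.
have sdt : <[d]> \subset <[t]> by rewrite Dd cycle_zexpg cycleX.
have edt : <[d]> = <[t]>.
  apply/eqP; rewrite eqEcard sdt /=; apply: d_max.
  by rewrite /P (subsetP sTK) // (subsetP sdt).
have co_m : coprime #[t] `|m|%N.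
  by rewrite -generator_coprime /generator -cycle_zexpg -Dd edt.
rewrite -has_count; apply/hasP; exists m; first exact/MsP.
rewrite cycle_zexpg eq_sym -[_ == _]/(generator <[c]> _) generator_coprime.
by apply: coprime_dvdl co_m; rewrite edt in cd; exact: order_dvdG cd.
Qed.

Lemma complete_splitting_quotient (gT : finGroupType) (G H : {group gT})
    (M : int -> Prop) (S : {set gT}) (T : {set coset_of H}) (s : gT) :
    H <| G -> complete_splitting G M S -> splitting (G / H)%G M T ->
    s \in S -> s \notin H ->
  exists2 t, t \in T & <[t]> = <[coset H s]>.
Proof.
move=> nsHG csS spT Ss nHs.
have [Ms uMs MsP] := complete_splitting_enum csS.
have [sSG repS] := csS; have [sTG repT _] := spT.
have sGN : G \subset 'N(H) := normal_norm nsHG.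
(* Two candidate solutions on [G / H]: the number of elements of [S] above [x], and the indicator of
   [T] weighted by the size of a coset. *)
pose f1 x := #|[set u in S | coset H u == x]|.
pose f2 (x : coset_of H) := ((x \in T) * #|H|)%N.
have f1_sum c : c \in G / H ->
    (\sum_(x in G / H) f1 x * generation_count Ms x c
      = #|[pred g | g \in G & <[coset H g]> == <[c]>]|)%N.
  move=> Gc; rewrite (card_represented (S := S) uMs MsP) => [|g /andP[/repS]] //.
  rewrite [RHS](partition_big (coset H) (mem (G / H))) /= => [|u Su]; last first.
    by rewrite mem_quotient ?(subsetP sSG).
  apply: eq_bigr => x Gx; rewrite /f1 -sum1_card big_distrl /=.
  rewrite (eq_bigl (fun u => (u \in S) && (coset H u == x))) => [|u]; last first.
    by rewrite inE.
  apply: eq_bigr => u /andP[/(subsetP sSG) Gu /eqP <-]; rewrite mul1n.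
  apply: eq_count => m /=.
  by rewrite groupZX // coset_zexpg // (subsetP sGN).
have f2_sum c : c \in G / H -> c != 1 ->
    (\sum_(x in G / H) f2 x * generation_count Ms x c
      = #|[pred x in G / H | <[x]> == <[c]>]| * #|H|)%N.
  move=> Gc nt_c; rewrite (card_represented (S := T) uMs MsP) => [|x]; last first.
    case/andP=> Gx /eqP exc; apply: repT => //.
    by rewrite -cycle_eq1 exc cycle_eq1.
  rewrite big_distrl big_mkcond [RHS]big_mkcond; apply: eq_bigr => x _ /=.
  rewrite /f2; have [Tx | _] := boolP (x \in T); last by rewrite mul0n if_same.
  have Gx := subsetP sTG x Tx; rewrite Gx mul1n mulnC; congr (_ * _)%N.
  by apply: eq_count => m /=; rewrite groupZX.
(* The right-hand sides agree because each coset has [#|H|] elements. *)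
have fiber c : (#|[pred g | g \in G & <[coset H g]> == <[c]>]|
    = #|[pred x in G / H | <[x]> == <[c]>]| * #|H|)%N.
  rewrite -[LHS]sum1_card (partition_big (coset H) (mem (G / H))) /=; last first.
    by move=> g /andP[Gg _]; rewrite mem_quotient.
  rewrite -[X in _ = (X * _)%N]sum1_card big_distrl /= [RHS]big_mkcondr; apply: eq_bigr => x.
  case/morphimP=> g Ng Gg ->; rewrite mul1n.
  case: ifP => [exc | nexc]; last first.
    by rewrite big1 // => u /andP[/andP[_ +] /eqP eu]; rewrite eu nexc.
  rewrite sum1_card -(card_rcoset H g); apply: eq_card => u.
  apply/idP/idP => [/andP[/andP[Gu _] /eqP eu] | Hu].
    by apply/rcoset_kercosetP; rewrite ?(subsetP sGN).
  have [h Hh Du] := rcosetP Hu; have Gu : u \in G.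
    by rewrite Du groupM // (subsetP (normal_sub nsHG)).
  have Nu := subsetP sGN u Gu.
  apply/andP; split; last exact/eqP/rcoset_kercosetP.
  by apply/andP; rewrite (rcoset_kercosetP Nu Ng Hu).
have Gs : s \in G := subsetP sSG s Ss.
have Gc : coset H s \in G / H by rewrite mem_quotient.
have nt_c : coset H s != 1.
  by apply: contra nHs => /eqP; apply: coset_idr; rewrite (subsetP sGN).
have eq_sum : (\sum_(x in G / H | <[x]> == <[coset H s]>) f1 x
    = \sum_(x in G / H | <[x]> == <[coset H s]>) f2 x)%N.
  apply: (generator_sum_unique (Ms := Ms) (K := (G / H)%G)) => // c Kc nt.
    exact: splitting_generation_gt0 spT Kc nt.
  by rewrite f1_sum // f2_sum // fiber.
have [/existsP[t /and3P[_ /eqP etc Tt]] | /existsPn noT] :=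
    boolP [exists t, [&& t \in G / H, <[t]> == <[coset H s]> & t \in T]].
  by exists t.
(* If [T] had no such generator, the [f2] sum would vanish, whereas [s] itself contributes to the
   [f1] sum. *)
move/eqP: eq_sum; rewrite [X in _ == X]big1 => [|x /andP[Gx exc]].
  rewrite sum_nat_eq0 => /forallP/(_ (coset H s)).
  rewrite Gc eqxx /f1 cards_eq0 => /eqP/setP/(_ s).
  by rewrite !inE Ss eqxx.
by have := noT x; rewrite Gx exc /f2 /= => /negPf->.
Qed.

Theorem theorem2 (gT : finGroupType) (G H : {group gT}) (M : int -> Prop)
    (nHG : (H <| G)%g)
    (complG : completely_splits M G)
    (splitGH : splits M (G / H)%G) :
  forall S : {set gT},
    complete_splitting G M S -> complete_splitting H M (S :&: H).
Proof.
move=> S csS; have [T spT] := splitGH; have [sSG repS] := csS.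
split=> [|h Hh]; first exact: subsetIr.
have [[m s] [[/= Mm Ss Dh] rep_uniq]] := repS h (subsetP (normal_sub nHG) h Hh).
exists (m, s); split=> [|ms [Mms /setIP[Sms _] Dms]]; last exact: rep_uniq.
split=> //=; rewrite inE Ss /=; apply/negPn/negP => nHs.
have [t Tt ets] := complete_splitting_quotient nHG csS spT Ss nHs.
(* Since [h] is in [H], the multiplier [m] kills [coset H s]. It also kills [t], which has the same
   order, so [1] would be represented in the splitting of [G / H]. *)
have [_ _ []] := spT; exists (m, t); split=> //=; apply/esym/eqP.
rewrite zexpg_eq1 /order ets -/(order _) -zexpg_eq1 -coset_zexpg.
  by rewrite -Dh coset_id.
by rewrite (subsetP (normal_norm nHG)) // (subsetP sSG).
Qed.
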